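(* Let $R\subseteq S$ be rings such that $S$ is an excellent extension of $R$, and let $M$ be a left $S$-module (regarded also as a left $R$-module by restriction of scalars). Then the following assertions hold: (1) If $M$ is regular as a left $R$-module, then $M$ is regular as a left $S$-module. (2) If $M$ is regular as a left $S$-module and $M$ is torsion-free as a left $S$-module, then $M$ is regular as a left $R$-module.
   Context: Rings are associative with identity (not necessarily commutative) and modules are unital. Regular module (in the sense of Zelmanowitz): a left module $M$ over a ring $A$ is called regular if for each $m\in M$ there exists $g\in \mathrm{Hom}_A(M,A)$ such that $g(m)m=m$. Equivalently, for every $f\in \mathrm{Hom}_A(A,M)$ there exists $g\in \mathrm{Hom}_A(M,A)$ with $f=f\circ g\circ f$. Excellent extension: let $S$ be a ring and $R$ a subring of $S$ with the same identity $1$. $S$ is a free normalizing extension of $R$ if there exists a finite set $\{a_1,\dots,a_n\}\subseteq S$ such that $a_1=1$, $S=\sum_{i=1}^n a_iR$, $a_iR=Ra_i$ for all $i=1,\dots,n$, and $S$ is free with basis $\{a_1,\dots,a_n\}$ both as a left and as a right $R$-module. A free normalizing extension $R\subseteq S$ is called an excellent extension if, in addition, $S$ is left $R$-projective, meaning: whenever $N$ is an $S$-submodule of a left $S$-module $M$ such that $N$ is a direct summand of $M$ as a left $R$-module, then $N$ is a direct summand of $M$ as a left $S$-module. Torsion-free: a left $S$-module $M$ is torsion-free if for all $s\in S$ and $m\in M$, $sm=0$ implies $s=0$ or $m=0$. *)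

(* Defs.v *)
From HB Require Import structures.
From mathcomp Require Import all_boot all_order all_algebra.
Set Implicit Arguments.
Unset Strict Implicit.
Unset Printing Implicit Defensive.
Import GRing.Theory.
Local Open Scope ring_scope.

(* Rings are [pzRingType]s: possibly noncommutative, the zero ring allowed.
   Left modules are [lmodType]s, and [A^o] is A as a left module over itself. *)

Definition restrict_scalars (A B : pzRingType) (f : {rmorphism A -> B})
  (M : lmodType B) : Type := M.

Section RestrictScalars.
Variables (A B : pzRingType) (f : {rmorphism A -> B}) (M : lmodType B).
Local Notation V := (restrict_scalars f M).

HB.instance Definition _ := GRing.Zmodule.on V.

Definition restrict_scale (a : A) (m : V) : V := f a *: (m : M).

Fact restrict_scaleA a b m :
  restrict_scale a (restrict_scale b m) = restrict_scale (a * b) m.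
Proof. by rewrite /restrict_scale rmorphM scalerA. Qed.

Fact restrict_scale1 : left_id 1 restrict_scale.
Proof. by move=> m; rewrite /restrict_scale rmorph1 scale1r. Qed.

Fact restrict_scaleDr : right_distributive restrict_scale +%R.
Proof. by move=> a m m'; rewrite /restrict_scale -scalerDr. Qed.

Fact restrict_scaleDl m : {morph restrict_scale^~ m : a b / a + b}.
Proof. by move=> a b; rewrite /restrict_scale rmorphD scalerDl. Qed.

HB.instance Definition _ := GRing.Zmodule_isLmodule.Build A V
  restrict_scaleA restrict_scale1 restrict_scaleDr restrict_scaleDl.

End RestrictScalars.

(* Regular in the sense of Zelmanowitz. *)
Definition regular_module (A : pzRingType) (M : lmodType A) : Prop :=
  forall m : M, exists g : {linear M -> A^o}, (g m : A) *: m = m.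

Definition torsion_free (A : pzRingType) (M : lmodType A) : Prop :=
  forall (a : A) (m : M), a *: m = 0 -> a = 0 \/ m = 0.

Definition direct_summand (A : pzRingType) (M : lmodType A) (N : {pred M}) :
    Prop :=
  exists K : {pred M},
    [/\ submod_closed N, submod_closed K,
        forall x, x \in N -> x \in K -> x = 0
      & forall x, exists y z, [/\ y \in N, z \in K & x = y + z]].

Section Extension.

(* R is a subring of S with the same identity, with inclusion [val : R -> S]. *)
Variables (S : pzRingType) (P : {pred S}) (R : subPzRingType P).

Section Family.
Variables (n : nat) (a : 'I_n -> S).

Definition left_generating : Prop :=
  forall s : S, exists c : 'I_n -> R, s = \sum_i val (c i) * a i.

Definition right_generating : Prop :=
  forall s : S, exists c : 'I_n -> R, s = \sum_i a i * val (c i).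

Definition left_independent : Prop :=
  forall c : 'I_n -> R, \sum_i val (c i) * a i = 0 -> forall i, c i = 0.

Definition right_independent : Prop :=
  forall c : 'I_n -> R, \sum_i a i * val (c i) = 0 -> forall i, c i = 0.

Definition left_basis : Prop := left_generating /\ left_independent.

Definition right_basis : Prop := right_generating /\ right_independent.

(* a_i R = R a_i as subsets of S *)
Definition normalizing : Prop :=
  forall i (x : S),
    (exists r : R, x = a i * val r) <-> (exists r : R, x = val r * a i).

End Family.

Definition free_normalizing_extension : Prop :=
  exists (n : nat) (a : 'I_n.+1 -> S),
    [/\ a ord0 = 1, right_generating a, normalizing a,
        left_basis a & right_basis a].

(* "S is left R-projective" *)
Definition left_projective_extension : Prop :=
  forall (M : lmodType S) (N : {pred M}),
    submod_closed N ->
    direct_summand (M := restrict_scalars (val : {rmorphism R -> S}) M) N ->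
    direct_summand N.

Definition excellent_extension : Prop :=
  free_normalizing_extension /\ left_projective_extension.

End Extension.

(* Main.v *)
From HB Require Import structures.
Require Import Defs.
From mathcomp Require Import all_boot all_order all_algebra.
Import GRing.Theory.
Local Open Scope ring_scope.

(** From [R] up to [S]: for [m] in a module [M] regular over [R], the module
    [S m] is generated over [R] by the finitely many [a_i m],
    because the [a_i] generate [S] as a left [R]-module.  As in
    Zelmanowitz's theory, a finitely generated submodule of a regular module is
    a projective direct summand; concretely ([regular_dual_family]) there are
    [R]-linear forms [h_i] on [M] such that [x = \sum_i h_i x *: (a_i m)] on
    [S m].  Putting [sigma x = \sum_i h_i x * a_i] gives an [R]-linear map
    [M -> S] with [sigma x *: m = x] on [S m].  It does two things at once: it
    exhibits [S m] as an [R]-summand of [M], and the annihilator of [m] as an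
    [R]-summand of [S].  Relative projectivity makes both of them [S]-summands
    ([lift_retraction]); then [M] projects [S]-linearly onto [S m], which is
    isomorphic to the left ideal [S e] for an idempotent [e] with [e m = m],
    and the composite [M -> S m -> S e] is the form required at [m]
    ([linear_form_lift]).

    From [S] down to [R]: when [M] is torsion-free, [g m *: m = m] with
    [m != 0] forces [g m = 1].  Following [g] by the coordinate of [S] along
    the basis element [1] gives an [R]-linear form which is still [1] at
    [m]. *)

(** Summands are handled below through linear retractions, because maps, unlike
    complements, can be composed. *)
Lemma direct_summandP (A : pzRingType) (V : lmodType A) (N : {pred V}) :
  direct_summand N <->
  exists p : V -> V,
    [/\ linear p, forall x, p x \in N & forall x, x \in N -> p x = x].
Proof.
split=> [[K [[N0 Nlin] [K0 Klin] NK0 decN]]|[p [plin pN pid]]].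
  have decNb x : exists y, (y \in N) && (x - y \in K).
    by have [y [z [Ny Kz ->]]] := decN x; exists y; rewrite Ny addrC addKr.
  pose p x := xchoose (decNb x).
  have pN x : p x \in N by case/andP: (xchooseP (decNb x)).
  have pK x : x - p x \in K by case/andP: (xchooseP (decNb x)).
  have p_unique x y : y \in N -> x - y \in K -> p x = y.
    move=> Ny Kxy; apply/eqP; rewrite -subr_eq0; apply/eqP/NK0.
      by rewrite addrC -scaleN1r; apply: Nlin.
    have -> : p x - y = -1 *: (x - p x) + (x - y).
      by rewrite scaleN1r opprB addrA subrK.
    exact: Klin.
  exists p; split=> // [a x y|x Nx]; last by apply: p_unique; rewrite ?subrr.
  apply: p_unique; first exact: Nlin.
  by rewrite opprD addrACA -scalerBr; apply: Klin.
have p0 : p 0 = 0.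
  by have := plin (-1) 0 0; rewrite !scaleN1r !addNr.
pose K : {pred V} := fun x => p x == 0.
have KE x : (x \in K) = (p x == 0) by [].
exists K; split.
- split; first by rewrite -p0.
  by move=> a x y /pid <- /pid <-; rewrite -plin.
- split; first by rewrite KE p0.
  move=> a x y; rewrite !KE plin => /eqP -> /eqP ->.
  by rewrite scaler0 addr0.
- by move=> x /pid px; rewrite KE px => /eqP.
- move=> x; exists (p x), (x - p x); split=> //; last by rewrite addrC subrK.
  rewrite KE; have -> : x - p x = -1 *: p x + x by rewrite scaleN1r addrC.
  by rewrite plin pid // scaleN1r addNr.
Qed.

(** The forms are built one vector at a time.  If [p] is the projection onto
    the span of the vectors already treated, the next vector [w] only
    contributes the part [y = w - p w] that [p] misses; a form [g] with
    [g y *: y = y], evaluated on [x - p x], corrects [p] at [w] without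
    disturbing the fixed vectors of [p]. *)
Lemma regular_dual_family (A : pzRingType) (V : lmodType A) (n : nat)
    (v : 'I_n -> V) :
  regular_module V ->
  exists h : 'I_n -> V -> A,
    (forall j a x y, h j (a *: x + y) = a * h j x + h j y) /\
    (forall i, \sum_j h j (v i) *: v j = v i).
Proof.
move=> regV; elim: n v => [|n IHn] v.
  by exists (fun=> fun=> 0); split=> -[].
have [h [hlin hv]] := IHn (fun i => v (lift ord0 i)).
pose p x := \sum_j h j x *: v (lift ord0 j).
have plin a x y : p (a *: x + y) = a *: p x + p y.
  rewrite /p scaler_sumr -big_split; apply: eq_bigr => j _ /=.
  by rewrite hlin scalerDl scalerA.
have [g gy] := regV (v ord0 - p (v ord0)).
pose k x : A := g (x - p x).
have klin a x y : k (a *: x + y) = a * k x + k y.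
  by rewrite /k plin opprD addrACA -scalerBr linearP.
(* The coefficients at the earlier vectors also absorb the multiple of
   [p (v ord0)] that [k x *: y] contains, where [y = v ord0 - p (v ord0)]. *)
pose h' j x := if unlift ord0 j is Some i then h i x - k x * h i (v ord0)
               else k x.
have h'E x : \sum_j h' j x *: v j = p x + k x *: (v ord0 - p (v ord0)).
  rewrite big_ord_recl /h' unlift_none scalerBr [RHS]addrCA; congr (_ + _).
  rewrite /p scaler_sumr -sumrB; apply: eq_bigr => j _.
  by rewrite liftK scalerBl scalerA.
exists h'; split=> [j a x y|i].
  rewrite /h'; case: (unlift ord0 j) => [i|]; last exact: klin.
  by rewrite hlin klin mulrDl mulrBr mulrA opprD addrACA.
rewrite h'E; case: (unliftP ord0 i) => [j|] ->.
  have pj : p (v (lift ord0 j)) = v (lift ord0 j) by exact: hv.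
  by rewrite /k pj subrr linear0 scale0r addr0.
by rewrite /k gy addrC subrK.
Qed.

Section Extension.
Variables (S : pzRingType) (P : {pred S}) (R : subPzRingType P).

Lemma lift_retraction (V : lmodType S) (N : {pred V}) (p : V -> V) :
    left_projective_extension R -> submod_closed N ->
    (forall (r : R) x y, p (val r *: x + y) = val r *: p x + p y) ->
    (forall x, p x \in N) -> (forall x, x \in N -> p x = x) ->
  exists q : V -> V,
    [/\ linear q, forall x, q x \in N & forall x, x \in N -> q x = x].
Proof.
move=> projR closedN plin pN pid; apply/direct_summandP/projR => //.
by apply/direct_summandP; exists p; split.
Qed.

Lemma val_linear0 (M : lmodType S) (sigma : M -> S) :
  (forall (r : R) x y, sigma (val r *: x + y) = val r * sigma x + sigma y) ->
  sigma 0 = 0.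
Proof.
by move=> /(_ (-1) 0 0); rewrite rmorphN1 scaleN1r mulN1r !addNr.
Qed.

(** [sigma] is a section over [R] of [s |-> s *: m] on its image [S m],
    extended to all of [M]. *)
Lemma linear_form_lift (M : lmodType S) (m : M) (sigma : M -> S) :
    left_projective_extension R ->
    (forall (r : R) x y, sigma (val r *: x + y) = val r * sigma x + sigma y) ->
    (forall s, sigma (s *: m) *: m = s *: m) ->
  exists g : {linear M -> S^o}, (g m : S) *: m = m.
Proof.
move=> projR sigma_lin sigmaK.
have sigma0 := val_linear0 _ _ sigma_lin.
(* The annihilator of [m] is an [R]-summand of [S], so an [S]-summand: this
   yields [e] such that [s *: m |-> s * e] is well defined on [S m]. *)
have [e em e_ann] : exists2 e : S, e *: m = m &
    forall s, s *: m = 0 -> s * e = 0.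
  pose Ann : {pred S^o} := fun s : S => s *: m == 0.
  have AnnE (s : S) : (s \in Ann) = (s *: m == 0) by [].
  have closedAnn : submod_closed Ann.
    split=> [|a s t]; first by rewrite AnnE scale0r.
    rewrite !AnnE => /eqP sm0 /eqP tm0.
    by rewrite scalerDl -scalerA sm0 tm0 scaler0 addr0.
  have [|s|s|q [qlin qAnn qid]] :=
    lift_retraction S^o Ann (fun s : S => s - sigma (s *: m)) projR closedAnn.
  - move=> r s t /=.
    by rewrite scalerDl -scalerA sigma_lin opprD addrACA -mulrBr.
  - by rewrite AnnE scalerBl sigmaK subrr.
  - by rewrite AnnE => /eqP ->; rewrite sigma0 subr0.
  have q0 : q 0 = 0 by apply: qid; rewrite AnnE scale0r.
  exists (1 - q 1).
    by have := qAnn 1; rewrite AnnE scalerBl scale1r => /eqP ->; rewrite subr0.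
  have q_mul (s : S) : q s = s * q 1.
    have := qlin s 1 0; rewrite q0 !addr0; apply: etrans.
    by congr q; exact: esym (mulr1 s).
  move=> s sm0; rewrite mulrBr mulr1 -q_mul qid ?subrr //.
  by rewrite AnnE sm0.
have e_eq s t : s *: m = t *: m -> s * e = t * e.
  move=> smtm; apply/eqP; rewrite -subr_eq0 -mulrBl; apply/eqP/e_ann.
  by rewrite scalerBl smtm subrr.
(* [S m] is the set of fixed points of [x |-> sigma x *: m], which makes
   membership in it boolean. *)
pose Sm : {pred M} := fun x => sigma x *: m == x.
have in_Sm x : (x \in Sm) = (sigma x *: m == x) by [].
have SmE s : s *: m \in Sm by rewrite in_Sm sigmaK.
have closedSm : submod_closed Sm.
  split=> [|a x y]; first by rewrite in_Sm sigma0 scale0r.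
  rewrite !in_Sm => /eqP <- /eqP <-.
  by rewrite scalerA -scalerDl sigmaK.
have [|//|x|q [qlin qSm qid]] :=
  lift_retraction M Sm (fun x => sigma x *: m) projR closedSm.
- by move=> r x y /=; rewrite sigma_lin scalerDl scalerA.
- by move/eqP.
have sigma_q x : sigma (q x) *: m = q x by apply/eqP/qSm.
pose g x : S^o := sigma (q x) * e.
have glin : linear g.
  move=> a x y; rewrite -[a *: g x]/(a * g x) /g mulrA -mulrDl; apply: e_eq.
  by rewrite scalerDl -scalerA !sigma_q qlin.
pose g_linear : {linear M -> S^o} :=
  HB.pack g (GRing.isLinear.Build S M S^o *:%R g glin).
by exists g_linear; rewrite /= /g -scalerA em sigma_q qid // -[m]scale1r.
Qed.

Lemma left_basis_coordinate (n : nat) (a : 'I_n -> S) (i : 'I_n) :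
  left_basis R a ->
  exists c : S -> R,
    (forall r s t, c (val r * s + t) = r * c s + c t) /\ c (a i) = 1.
Proof.
move=> [gen indep].
have genb s : exists f : {ffun 'I_n -> R}, s == \sum_j val (f j) * a j.
  have [f ->] := gen s; exists (finfun f); apply/eqP.
  by apply: eq_bigr => j _; rewrite ffunE.
pose c s j := xchoose (genb s) j.
have cE s : s = \sum_j val (c s j) * a j by apply/eqP/(xchooseP (genb s)).
have c_unique s (f : 'I_n -> R) : s = \sum_j val (f j) * a j -> c s =1 f.
  move=> sE j; apply/eqP; rewrite -subr_eq0.
  apply/eqP; move: j; apply: (indep (fun j => c s j - f j)).
  under eq_bigr do rewrite rmorphB mulrBl.
  by rewrite sumrB -cE -sE subrr.
exists (c^~ i); split=> [r s t|].
  apply: (c_unique _ (fun j => r * c s j + c t j)).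
  under eq_bigr do rewrite rmorphD rmorphM mulrDl -mulrA.
  by rewrite big_split -mulr_sumr -!cE.
rewrite (c_unique _ (fun j => (j == i)%:R)) ?eqxx //.
rewrite (bigD1 i) //= eqxx rmorph1 mul1r big1 ?addr0 // => j /negPf ->.
by rewrite rmorph0 mul0r.
Qed.

End Extension.

Theorem theorem2p2 (S : pzRingType) (P : {pred S}) (R : subPzRingType P)
    (RS_excellent : excellent_extension R) (M : lmodType S) :
  (regular_module (restrict_scalars (val : {rmorphism R -> S}) M) ->
     regular_module M) /\
  (regular_module M -> torsion_free M ->
     regular_module (restrict_scalars (val : {rmorphism R -> S}) M)).
Proof.
have [[n [a [a0 _ _ lbasis _]]] projR] := RS_excellent.
split=> [regM m|regM tfM m].
  pose V := restrict_scalars (val : {rmorphism R -> S}) M.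
  have [h [hlin hm]] := regular_dual_family R V n.+1 (fun i => a i *: m) regM.
  pose sigma (x : M) : S := \sum_j val (h j x) * a j.
  have sigma_lin (r : R) x y :
      sigma (val r *: x + y) = val r * sigma x + sigma y.
    rewrite /sigma mulr_sumr -big_split; apply: eq_bigr => j _ /=.
    by rewrite (hlin j r x y) rmorphD rmorphM mulrDl mulrA.
  have sigma_am i : sigma (a i *: m) *: m = a i *: m.
    rewrite -[RHS]hm scaler_suml; apply: eq_bigr => j _.
    by rewrite -scalerA.
  clearbody sigma.
  apply: (linear_form_lift _ _ R _ _ sigma projR sigma_lin) => s.
  have [c ->] := lbasis.1 s.
  have sigma0 := val_linear0 _ _ R _ _ sigma_lin.
  rewrite scaler_suml.
  apply: (big_ind (fun x => sigma x *: m = x)) => [|x y IHx IHy|i _].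
  - by rewrite sigma0 scale0r.
  - have := sigma_lin 1 x y.
    by rewrite rmorph1 scale1r mul1r => ->; rewrite scalerDl IHx IHy.
  - have := sigma_lin (c i) (a i *: m) 0.
    by rewrite !addr0 sigma0 addr0 -!scalerA => ->; rewrite -scalerA sigma_am.
have [->|m_neq0] := eqVneq m 0.
  by exists \0; rewrite scaler0.
have [g gm] := regM m.
have gm1 : g m = 1.
  have [|/eqP|m0] := tfM (g m - 1) m.
  - by rewrite scalerBl scale1r gm subrr.
  - by rewrite subr_eq0 => /eqP.
  - by rewrite m0 eqxx in m_neq0.
have [c [clin c1]] := left_basis_coordinate _ _ R _ a ord0 lbasis.
pose V := restrict_scalars (val : {rmorphism R -> S}) M.
pose f (x : V) : R^o := c (g x).
have flin : linear f.
  by move=> r x y; rewrite /f [g _](linearP g (val r) x y) clin.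
pose f_linear : {linear V -> R^o} :=
  HB.pack f (GRing.isLinear.Build R V R^o *:%R f flin).
by exists f_linear; rewrite /= /f gm1 -a0 c1 scale1r.
Qed.
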